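(* Let $(y_i,p_i)$, $0\le i\le n$, be Hermite data and let $\tau_i=\frac{y_i-y_{i-1}}{h_i}$; assume $0<p_{i-1}<\tau_i<p_i$ for $1\le i\le n$. For a choice of parameters $\theta_i\in\,]0,\frac14]$, $1\le i\le n$, let $g\in GS_2(I,X,\beta)$, with $\beta_i=\frac{-2\theta_i}{1-2\theta_i}$, be the unique generalized quadratic spline with $g(x_i)=y_i$ and $g'(x_i)=p_i$ for $0\le i\le n$. Then for each $1\le i\le n$ the following choices make $g$ increasing and convex on $I_i$: (i) if $\frac14(3p_{i-1}+p_i)\le\tau_i\le\frac14(p_{i-1}+3p_i)$, one can choose $\theta_i=\frac14$, and then the local interpolant $g|_{I_i}$ is an ordinary quadratic spline; (ii) otherwise the local interpolant is a generalized quadratic spline, with the following choice: (a) if $\tau_i<\frac14(3p_{i-1}+p_i)$, choose any $\theta_i>0$ with $\theta_i\le\bar\theta_i:=\frac{\tau_i-p_{i-1}}{p_i-p_{i-1}}$; (b) if $\tau_i>\frac14(p_{i-1}+3p_i)$, choose any $\theta_i>0$ with $\theta_i\le\bar\theta_i:=\frac{p_i-\tau_i}{p_i-p_{i-1}}$. In both cases (a) and (b), the local interpolant belongs to $V(\beta_i)$ with $\beta_i=\frac{-2\theta_i}{1-2\theta_i}$.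
   Context: Setting. Let $n\ge 1$, $I=[a,b]$, $X=\{a=x_0<x_1<\dots<x_n=b\}$ a partition of $I$, $I_i=[x_{i-1},x_i]$, $h_i=x_i-x_{i-1}$ for $1\le i\le n$. Let $\beta=(\beta_1,\dots,\beta_n)$ with $\beta_i\in[-1,0[$ and $\theta_i=\frac12\frac{\beta_i}{\beta_i-1}\in\,]0,\frac14]$ (equivalently $\beta_i=\frac{-2\theta_i}{1-2\theta_i}$). The space $V(\beta_i)$ (generated by the Merrien subdivision algorithm) is the set of $C^1$ functions $f$ on $I_i$ such that for every dyadic subinterval $[u,v]$ of $I_i$ (i.e. every interval obtained from $I_i$ by repeated bisection, including $I_i$ itself), with $m=\frac12(u+v)$ and $h=v-u$, $$f(m)=\tfrac12\big(f(u)+f(v)-\theta_i h\,(f'(v)-f'(u))\big),\qquad f'(m)=\frac{1}{1-2\theta_i}\Big(\frac{f(v)-f(u)}{h}-2\theta_i\,\frac{f'(u)+f'(v)}{2}\Big).$$ It is known that for any prescribed values of $f,f'$ at the two endpoints of $I_i$ there is exactly one such $f$; so $\dim V(\beta_i)=4$. $GS_2(\beta)=GS_2(I,X,\beta)$ is the space of all $g\in C^1(I)$ with $g|_{I_i}\in V(\beta_i)$ for all $1\le i\le n$ (generalized quadratic splines). Each $g$ is uniquely determined by the Hermite data $g(x_i),g'(x_i)$, $0\le i\le n$, which can be prescribed arbitrarily. ''Increasing'' is understood in the weak sense (nondecreasing). An ordinary quadratic spline on $I_i$ means a $C^1$ piecewise quadratic polynomial with a single knot at the midpoint of $I_i$ (this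 corresponds to $\theta_i=\frac14$, $\beta_i=-1$). *)

(* Defs.v *)
From mathcomp Require Import all_boot all_order all_algebra.
From mathcomp Require Import all_classical all_reals all_analysis.
Set Implicit Arguments.
Unset Strict Implicit.
Unset Printing Implicit Defensive.
Import Order.TTheory GRing.Theory Num.Theory.
Import numFieldNormedType.Exports.
Local Open Scope classical_set_scope.
Local Open Scope ring_scope.

(* A function on [c, d] is represented by a total f : R -> R. Everything below
   only depends on the values of f on [c, d]: the difference quotient at x is
   restricted to points of [c, d] other than x, so the derivative is two-sided
   inside and one-sided at c and d. *)
Definition diff_quot_itv (R : realType) (c d : R) (f : R -> R) (x : R) :=
  (f y - f x) / (y - x) @[y --> within `[c, d] x^'].

Definition derive_itv (R : realType) (c d : R) (f : R -> R) (x : R) : R :=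
  lim (diff_quot_itv c d f x).

Definition C1_itv (R : realType) (c d : R) (f : R -> R) : Prop :=
  (forall x, x \in `[c, d] -> cvg (diff_quot_itv c d f x)) /\
  {within `[c, d], continuous (derive_itv c d f)}.

Inductive dyadic_subitv (R : realType) (c d : R) : R -> R -> Prop :=
| dyadic_self : dyadic_subitv c d c d
| dyadic_left u v :
    dyadic_subitv c d u v -> dyadic_subitv c d u ((u + v) / 2)
| dyadic_right u v :
    dyadic_subitv c d u v -> dyadic_subitv c d ((u + v) / 2) v.

Definition theta_of_beta (R : realType) (beta : R) : R :=
  2^-1 * (beta / (beta - 1)).

Definition beta_of_theta (R : realType) (theta : R) : R :=
  (- (2 * theta)) / (1 - 2 * theta).

(* The space V(beta) on [c, d]: the C^1 functions reproduced by the Merrien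
   subdivision scheme on every dyadic subinterval. *)
Definition V_space (R : realType) (beta c d : R) : set (R -> R) :=
  [set f | C1_itv c d f /\
    forall u v, dyadic_subitv c d u v ->
      let theta := theta_of_beta beta in
      let f' := derive_itv c d f in
      let m := (u + v) / 2 in
      let h := v - u in
      f m = 2^-1 * (f u + f v - theta * h * (f' v - f' u)) /\
      f' m = (1 - 2 * theta)^-1 *
             ((f v - f u) / h - 2 * theta * ((f' u + f' v) / 2))].

Definition is_partition (R : realType) (a b : R) (n : nat) (x : nat -> R) :=
  [/\ x 0 = a, x n = b & forall i, (1 <= i <= n)%N -> x i.-1 < x i].

(* Only x 0, ..., x n and beta 1, ..., beta n are relevant. *)
Definition GS2 (R : realType) (a b : R) (n : nat) (x beta : nat -> R) :
    set (R -> R) :=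
  [set g | C1_itv a b g /\
    forall i, (1 <= i <= n)%N -> V_space (beta i) (x i.-1) (x i) g].

Definition slope (R : realType) (x y : nat -> R) (i : nat) : R :=
  (y i - y i.-1) / (x i - x i.-1).

Definition increasing_on (R : realType) (c d : R) (f : R -> R) : Prop :=
  {in `[c, d] &, {homo f : s t / s <= t}}.

Definition convex_on (R : realType) (c d : R) (f : R -> R) : Prop :=
  @convex_function R R^o `[c, d] f.

Definition quadratic_spline (R : realType) (c d : R) (f : R -> R) : Prop :=
  C1_itv c d f /\
  exists q1 q2 : {poly R},
    [/\ (size q1 <= 3)%N, (size q2 <= 3)%N,
        {in `[c, (c + d) / 2], forall t, f t = q1.[t]} &
        {in `[(c + d) / 2, d], forall t, f t = q2.[t]}].

(* Main.v *)
Require Import Defs.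
From mathcomp Require Import all_boot all_order all_algebra.
From mathcomp Require Import all_classical all_reals all_analysis.
From mathcomp Require Import ring lra.
Import Order.TTheory GRing.Theory Num.Theory.
Import numFieldNormedType.Exports.
Set Implicit Arguments.
Unset Strict Implicit.
Unset Printing Implicit Defensive.
Local Open Scope classical_set_scope.
Local Open Scope ring_scope.

(** On one piece [[c, d]] of the partition write [m] for the midpoint of a dyadic
    subinterval [[u, v]], [A = f' u], [B = f' v], [M = f' m], and [s] for the slope
    of the chord of [f] over [[u, v]]. The subdivision identities are equivalent to
    [(1 - 2 theta) (M - A) = s - A - theta (B - A)] and
    [(1 - 2 theta) (B - M) = B - s - theta (B - A)], together with chord slopes
    [A + (1 - 2 theta) (M - A)] and [B - (1 - 2 theta) (B - M)] on the two halves
    ([merrien_halves]). Hence the condition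
      [A + theta (B - A) <= s <= B - theta (B - A)]
    says exactly that [A <= M <= B], and it is inherited by both halves as soon as
    [theta <= 1/3] ([convexity_range_dyadic]). On all of [[c, d]] it says
    [theta <= (tau - p0) / (p1 - p0)] and [theta <= (p1 - tau) / (p1 - p0)], where
    [p0], [p1] are the end derivatives and [tau] the chord slope: the first is the
    choice in (a), the second the choice in (b), and for [theta = 1/4] the two
    together are the hypothesis of (i). In (a) and (b) the other inequality follows
    from [theta <= 1/4].

    So [f'] is nondecreasing along dyadic points, hence on [[c, d]] by density and
    continuity ([dyadic_nondecreasing], [merrien_derivative_nondecreasing]); it
    starts at [p0 > 0], and the mean value theorem makes [f] increasing and convex
    ([increasing_convex_of_derive]).

    For [theta = 1/4] the chord slope of each half is [(A + M) / 2], respectively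
    [(M + B) / 2]; these are the Hermite data of a quadratic, and quadratics satisfy
    the subdivision identities for [theta = 1/4], so [f] is quadratic on both halves
    ([V_space_quarter_quadratic_spline]). *)

(** * One-sided derivatives on an interval *)

(** Needed for limits along this filter to be unique: at an endpoint only one
    side of the punctured neighbourhood is left, and it is still nonempty. *)
Lemma within_itv_dnbhs_proper (R : realType) (c d x : R) :
  c < d -> x \in `[c, d] -> ProperFilter (within `[c, d] x^').
Proof.
move=> cd; rewrite in_itv/= => /andP[cx xd]; apply: Build_ProperFilter_ex.
move=> P [e /= e0 He].
have [xltd|dx] := ltP x d.
  pose y := x + Num.min (e / 2) (d - x).
  have y1 : y <= x + e / 2 by rewrite lerD2l ge_min lexx.
  have y2 : y <= x + (d - x) by rewrite lerD2l ge_min lexx orbT.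
  have y3 : x < y by rewrite ltrDl lt_min; apply/andP; split; lra.
  exists y; apply: He => /=.
  - by rewrite ltr_distlC; apply/andP; split; lra.
  - by rewrite gt_eqF.
  - by rewrite in_itv/=; apply/andP; split; lra.
pose y := x - Num.min (e / 2) (x - c).
have y1 : x - e / 2 <= y by rewrite lerD2l lerN2 ge_min lexx.
have y2 : x - (x - c) <= y by rewrite lerD2l lerN2 ge_min lexx orbT.
have y3 : y < x by rewrite gtrDl oppr_lt0 lt_min; apply/andP; split; lra.
exists y; apply: He => /=.
- by rewrite ltr_distlC; apply/andP; split; lra.
- by rewrite lt_eqF.
- by rewrite in_itv/=; apply/andP; split; lra.
Qed.

(** Restricting the difference quotient to a smaller interval restricts the
    filter, so the limit stays the same. This transfers Hermite data given on the
    whole spline interval to each piece, where the endpoint derivative becomes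
    one-sided. *)
Lemma derive_itv_subitv (R : realType) (a b c d : R) (f : R -> R) (x : R) :
  a <= c -> c < d -> d <= b -> x \in `[c, d] -> cvg (diff_quot_itv a b f x) ->
  derive_itv c d f x = derive_itv a b f x.
Proof.
move=> ac cd db xcd f_cvg.
have := within_itv_dnbhs_proper cd xcd => PF.
apply: cvg_lim => //; apply: cvg_trans; last exact: f_cvg.
apply: cvg_app => P; rewrite !nbhs_filterE /within /=; apply: filterS => y Py ycd.
apply: Py; move: ycd; rewrite !in_itv/= => /andP[cy yd].
by rewrite (le_trans ac cy) (le_trans yd db).
Qed.

Lemma C1_itv_is_derive (R : realType) (c d : R) (f : R -> R) (x : R) :
  C1_itv c d f -> x \in `]c, d[ -> is_derive x 1 f (derive_itv c d f x).
Proof.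
move=> [f_cvg _] xcd.
have x_in : x \in `[c, d] by apply: subset_itv_oo_cc.
have lim_h :
    h^-1 *: (f (h *: 1 + x) - f x) @[h --> 0^'] --> derive_itv c d f x.
  apply/cvgrPdist_lt => e e0.
  have /cvgrPdist_lt/(_ _ e0) := f_cvg _ x_in.
  have /nbhs_ballP[r /= r0 xr] := near_in_itvoo xcd.
  rewrite /within/= => -[s /= s0 xs]; exists (Num.min r s) => /=.
    by rewrite lt_min r0 s0.
  move=> h /=; rewrite sub0r normrN lt_min => /andP[hr hs] h0.
  have := xs (h + x) _ _ _; rewrite addrK mulrC [h *: 1]mulr1; apply.
  - by rewrite /= opprD addrCA subrr addr0 normrN.
  - by rewrite -subr_eq0 addrK.
  - apply: subset_itv_oo_cc; apply: xr.
    by rewrite /ball /= opprD addrCA subrr addr0 normrN.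
by apply: DeriveDef; [apply/cvg_ex; eexists; exact: lim_h|exact: cvg_lim].
Qed.

Lemma C1_itv_continuous (R : realType) (c d : R) (f : R -> R) :
  C1_itv c d f -> {within `[c, d], continuous f}.
Proof.
move=> [f_cvg _]; apply/subspace_continuousP => x /= x_in.
set l := derive_itv c d f x.
apply/cvgrPdist_lt => e e0.
have /cvgrPdist_lt/(_ _ ltr01) := f_cvg _ x_in.
rewrite -/(derive_itv c d f x) -/l => -[s /= s0 xs].
have M0 : 0 < `|l| + 1 by rewrite ltr_wpDl.
exists (Num.min s (e / (`|l| + 1))) => /=; first by rewrite lt_min s0 divr_gt0.
move=> y /=; rewrite lt_min => /andP[ys ye] ycd.
have [->|yx] := eqVneq y x; first by rewrite subrr normr0.
have := xs y ys yx ycd; set q := (f y - f x) / (y - x) => lq.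
(* near x the quotient q is within 1 of l, so f is Lipschitz there with constant
   |l| + 1 *)
have -> : f x - f y = q * (x - y).
  by rewrite /q -[f x - f y]opprB -[x - y]opprB mulrN divfK// subr_eq0.
rewrite normrM; apply: (@le_lt_trans _ _ ((`|l| + 1) * `|x - y|)).
  apply: ler_wpM2r => //; have := lerB_dist q l; rewrite distrC; lra.
by rewrite mulrC -ltr_pdivlMr.
Qed.

(** The mean value theorem turns a sign of the derivative into monotonicity, and
    its monotonicity into convexity: at the point [m] between [s] and [t] with
    weight [w], the gap between chord and function is
    [w (1 - w) (t - s)] times a difference of derivatives at two ordered points. *)
Lemma increasing_convex_of_derive (R : realType) (c d : R) (f : R -> R) :
  C1_itv c d f ->
  (forall x, x \in `[c, d] -> 0 <= derive_itv c d f x) ->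
  {in `[c, d] &, {homo derive_itv c d f : s t / s <= t}} ->
  increasing_on c d f /\ convex_on c d f.
Proof.
move=> fC1 f'_ge0 f'_mono.
have mvt s t : s \in `[c, d] -> t \in `[c, d] -> s <= t ->
    exists2 z, s <= z <= t &
      z \in `[c, d] /\ f t - f s = derive_itv c d f z * (t - s).
  rewrite !in_itv/= => /andP[cs sd] /andP[ct td] st.
  have [||z zst eq_z] := @MVT_segment _ f (derive_itv c d f) s t st.
  - move=> z; rewrite in_itv/= => /andP[sz zt]; apply: C1_itv_is_derive => //.
    by rewrite in_itv/= (le_lt_trans cs sz) (lt_le_trans zt td).
  - apply: continuous_subspaceW (C1_itv_continuous fC1) => z /=.
    rewrite !in_itv/= => /andP[sz zt].
    by rewrite (le_trans cs sz) (le_trans zt td).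
  - move: zst; rewrite in_itv/= => /andP[sz zt]; exists z; first by rewrite sz.
    by rewrite in_itv/= (le_trans cs sz) (le_trans zt td).
split.
  move=> s t s_in t_in st; have [z _ [z_in eq_z]] := mvt s t s_in t_in st.
  by rewrite -subr_ge0 eq_z mulr_ge0 ?f'_ge0 ?subr_ge0.
have conv_le (w s t : R) : s \in `[c, d] -> t \in `[c, d] -> s <= t ->
    0 <= w <= 1 -> f (w * s + (1 - w) * t) <= w * f s + (1 - w) * f t.
  move=> s_in t_in st /andP[w0 w1]; set m := w * s + (1 - w) * t.
  have ms : m - s = (1 - w) * (t - s) by rewrite /m; ring.
  have tm : t - m = w * (t - s) by rewrite /m; ring.
  have sm : s <= m by rewrite -subr_ge0 ms mulr_ge0 ?subr_ge0.
  have mt : m <= t by rewrite -subr_ge0 tm mulr_ge0 ?subr_ge0.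
  have m_in : m \in `[c, d].
    move: s_in t_in; rewrite !in_itv/= => /andP[cs _] /andP[_ td].
    by rewrite (le_trans cs sm) (le_trans mt td).
  have [z1 /andP[_ z1m] [z1_in eq1]] := mvt s m s_in m_in sm.
  have [z2 /andP[mz2 _] [z2_in eq2]] := mvt m t m_in t_in mt.
  have z12 := f'_mono _ _ z1_in z2_in (le_trans z1m mz2).
  rewrite ms in eq1; rewrite tm in eq2.
  rewrite -subr_ge0.
  have -> : w * f s + (1 - w) * f t - f m =
            (1 - w) * (f t - f m) - w * (f m - f s) by ring.
  rewrite eq1 eq2.
  have -> : (1 - w) * (derive_itv c d f z2 * (w * (t - s))) -
            w * (derive_itv c d f z1 * ((1 - w) * (t - s))) =
    w * (1 - w) * (t - s) * (derive_itv c d f z2 - derive_itv c d f z1) by ring.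
  by rewrite !mulr_ge0 ?subr_ge0.
move=> w s t; rewrite !inE => s_in t_in; rewrite !convRE /unstable.onem.
have w01 : 0 <= w%:num <= 1 by apply/andP; split.
(* unordered points: exchange them together with their weights *)
have [st|/ltW ts] := leP s t; first exact: conv_le.
have w'01 : 0 <= 1 - w%:num <= 1.
  by move/andP: w01 => [w0 w1]; apply/andP; split; lra.
have := conv_le _ _ _ t_in s_in ts w'01.
have -> : 1 - (1 - w%:num) = w%:num by ring.
by rewrite addrC [X in _ <= X]addrC.
Qed.

(** * Dyadic subintervals *)

Lemma dyadic_subitv_bounds (R : realType) (c d u v : R) :
  c < d -> dyadic_subitv c d u v -> [/\ c <= u, u < v & v <= d].
Proof.
by move=> cd; elim => [//|u' v' _ [cu uv vd]|u' v' _ [cu uv vd]]; split; lra.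
Qed.

Lemma dyadic_subitv_trans (R : realType) (c d u v s t : R) :
  dyadic_subitv c d u v -> dyadic_subitv u v s t -> dyadic_subitv c d s t.
Proof.
by move=> cduv; elim => [//|s' t' _|s' t' _]; [exact: dyadic_left|exact: dyadic_right].
Qed.

(** Density of the dyadic points, in the form of arbitrarily short dyadic
    intervals around any point: bisect and keep a half that contains it. *)
Lemma dyadic_subitv_around (R : realType) (c d x e : R) :
  x \in `[c, d] -> 0 < e ->
  exists u v, [/\ dyadic_subitv c d u v, u <= x <= v & v - u < e].
Proof.
rewrite in_itv/= => /andP[cx xd] e0.
have halving (n : nat) : exists u v,
    [/\ dyadic_subitv c d u v, u <= x <= v & v - u = (d - c) / 2 ^+ n].
  elim: n => [|n [u [v [cduv /andP[ux xv] uvE]]]].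
    by exists c, d; rewrite cx xd expr0 divr1; split=> //; exact: dyadic_self.
  have half : (d - c) / 2 ^+ n.+1 = (v - u) / 2.
    by rewrite uvE exprSr invfM mulrA.
  have [xm|/ltW mx] := leP x ((u + v) / 2).
    exists u, ((u + v) / 2); rewrite half ux xm; split=> //; first exact: dyadic_left.
    by lra.
  exists ((u + v) / 2), v; rewrite half mx xv; split=> //; first exact: dyadic_right.
  by lra.
(* an integer N > (d - c) / e, hence also 2 ^ N > (d - c) / e *)
have cd0 : 0 <= (d - c) / e by rewrite divr_ge0 ?(ltW e0) // subr_ge0 (le_trans cx).
have [u [v [cduv xuv uvE]]] := halving (Num.bound ((d - c) / e)).
exists u, v; split=> //; rewrite uvE ltr_pdivrMr ?exprn_gt0 // mulrC -ltr_pdivrMr //.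
apply: (lt_trans (archi_boundP cd0)).
by rewrite -natrX ltr_nat ltn_expl.
Qed.

(** Endpoints of dyadic subintervals are dense, so a closed condition on the
    values of a continuous function need only be checked there. *)
Lemma dyadic_closed (R : realType) (c d : R) (F : R -> R) (C : set R) :
  c < d -> {within `[c, d], continuous F} -> closed C ->
  (forall u v, dyadic_subitv c d u v -> C (F u)) ->
  {in `[c, d], forall x, C (F x)}.
Proof.
move=> cd /subspace_continuousP F_cont C_closed C_dyadic x x_in.
apply: contrapT => nCFx.
have nearFx : \forall z \near F x, ~ C z.
  exact: (open_nbhs_nbhs (conj (closed_openC C_closed) nCFx)).
have [e /= e0 nearx] := F_cont x x_in _ nearFx.
have [u [v [cduv /andP[ux xv] uve]]] := dyadic_subitv_around x_in e0.
have [cu uv vd] := dyadic_subitv_bounds cd cduv.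
apply: (nearx u _ _ (C_dyadic _ _ cduv)).
  by rewrite /= ger0_norm ?subr_ge0 //; lra.
by rewrite /= in_itv/= cu (le_trans (ltW uv) vd).
Qed.

(** Two points [s < t] are separated by a dyadic point: take a dyadic interval
    around [s] shorter than [t - s]. It then suffices to compare an arbitrary
    point with a dyadic one, which is done by induction on the bisections: a point
    beyond the midpoint either lies in the adjacent half, where the hypothesis
    applies, or is already compared with an endpoint of the parent interval. *)
Lemma dyadic_nondecreasing (R : realType) (c d : R) (F : R -> R) :
  c < d ->
  (forall u v, dyadic_subitv c d u v ->
     {in `[u, v], forall x, F u <= F x <= F v}) ->
  {in `[c, d] &, {homo F : s t / s <= t}}.
Proof.
move=> cd F_between.
have compare u v : dyadic_subitv c d u v -> {in `[c, d], forall t,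
    [/\ t <= u -> F t <= F u, u <= t -> F u <= F t,
        t <= v -> F t <= F v & v <= t -> F v <= F t]}.
  move=> cduv t t_in.
  have mid u' v' m : dyadic_subitv c d u' m -> dyadic_subitv c d m v' ->
      u' <= m <= v' ->
      (t <= u' -> F t <= F u') -> (v' <= t -> F v' <= F t) ->
      (t <= m -> F t <= F m) /\ (m <= t -> F m <= F t).
    move=> cdum cdmv /andP[um mv] tu vt; split=> [tm|mt].
      have [ut|/ltW/tu Ftu] := leP u' t.
        by have /andP[] := F_between _ _ cdum t (introT andP (conj ut tm)).
      have /andP[Fum _] := F_between _ _ cdum m (introT andP (conj um (lexx m))).
      exact: le_trans Fum.
    have [tv|/ltW/vt Fvt] := leP t v'.
      by have /andP[] := F_between _ _ cdmv t (introT andP (conj mt tv)).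
    have /andP[_ Fmv] := F_between _ _ cdmv m (introT andP (conj (lexx m) mv)).
    exact: le_trans Fvt.
  have mid_in u' v' : dyadic_subitv c d u' v' -> u' <= (u' + v') / 2 <= v'.
    by move=> /(dyadic_subitv_bounds cd)[_ uv _]; apply/andP; split; lra.
  elim: cduv => [|u' v' cduv [tu ut tv vt]|u' v' cduv [tu ut tv vt]].
  - have /andP[Fc Fd] := F_between _ _ (dyadic_self c d) t t_in.
    have /andP[ct td] : c <= t <= d by [].
    split=> // [tc|dt].
      by have -> : t = c by apply/le_anti; rewrite tc.
    by have -> : t = d by apply/le_anti; rewrite dt td.
  - by have [] := mid _ _ _ (dyadic_left cduv) (dyadic_right cduv)
      (mid_in _ _ cduv) tu vt.
  - by have [] := mid _ _ _ (dyadic_left cduv) (dyadic_right cduv)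
      (mid_in _ _ cduv) tu vt.
move=> s t s_in t_in; rewrite le_eqVlt => /predU1P[->//|st].
have st0 : 0 < t - s by rewrite subr_gt0.
have [u [v [cduv /andP[us sv] uvst]]] := dyadic_subitv_around s_in st0.
have [_ _ Fsv _] := compare u v cduv s s_in.
have [_ _ _ Fvt] := compare u v cduv t t_in.
by apply: le_trans (Fsv sv) (Fvt _); lra.
Qed.

(** * The Merrien scheme preserves convexity *)

(** A function [f'] independent of [f] stands for the derivative: the scheme is an
    algebraic recursion on pairs of values at the dyadic points. *)
Definition merrien_scheme (R : realType) (theta c d : R) (f f' : R -> R) :=
  forall u v, dyadic_subitv c d u v ->
    f ((u + v) / 2) = 2^-1 * (f u + f v - theta * (v - u) * (f' v - f' u)) /\
    f' ((u + v) / 2) = (1 - 2 * theta)^-1 *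
      ((f v - f u) / (v - u) - 2 * theta * ((f' u + f' v) / 2)).

Definition chord (R : realType) (f : R -> R) (u v : R) := (f v - f u) / (v - u).

(** The algebra behind everything that follows. The increments of [f'] to and from
    the midpoint are, up to the positive factor [1 - 2 theta], the slacks of the
    chord slope in [convexity_range]; and the chord slopes of the two halves depend
    only on the derivatives at the ends of the half and the same factor. *)
Lemma merrien_halves (R : realType) (theta c d : R) (f f' : R -> R) (u v : R) :
  2 * theta < 1 -> c < d -> merrien_scheme theta c d f f' ->
  dyadic_subitv c d u v ->
  let m := (u + v) / 2 in
  [/\ (1 - 2 * theta) * (f' m - f' u) =
        chord f u v - (f' u + theta * (f' v - f' u)),
      (1 - 2 * theta) * (f' v - f' m) =
        (f' v - theta * (f' v - f' u)) - chord f u v,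
      chord f u m = f' u + (1 - 2 * theta) * (f' m - f' u) &
      chord f m v = f' v - (1 - 2 * theta) * (f' v - f' m)].
Proof.
move=> th cd scheme cduv m; have [fm f'm] := scheme _ _ cduv.
have [_ uv _] := dyadic_subitv_bounds cd cduv.
have th0 : 1 - 2 * theta != 0 by rewrite subr_eq0 eq_sym lt_eqF.
have h0 : v - u != 0 by rewrite subr_eq0 gt_eqF.
rewrite -/m in fm f'm.
have mu : m - u = (v - u) / 2 by rewrite /m; lra.
have vm : v - m = (v - u) / 2 by rewrite /m; lra.
rewrite /chord mu vm fm f'm; split; field; rewrite ?h0 ?th0 //.
Qed.

(** The range of chord slopes for which the scheme puts [f'] at the midpoint of
    [[u, v]] between [f' u] and [f' v]. *)
Definition convexity_range (R : realType) (theta : R) (f f' : R -> R) (u v : R) :=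
  f' u + theta * (f' v - f' u) <= chord f u v <= f' v - theta * (f' v - f' u).

Lemma derivative_mid_between (R : realType) (theta c d : R) (f f' : R -> R) (u v : R) :
  2 * theta < 1 -> c < d -> merrien_scheme theta c d f f' ->
  dyadic_subitv c d u v -> convexity_range theta f f' u v ->
  f' u <= f' ((u + v) / 2) <= f' v.
Proof.
move=> th2 cd scheme cduv /andP[lo hi].
have th2' : 0 < 1 - 2 * theta by rewrite subr_gt0.
have [f'um f'mv _ _] := merrien_halves th2 cd scheme cduv.
rewrite -subr_ge0 -(pmulr_rge0 _ th2') f'um subr_ge0 lo /=.
by rewrite -subr_ge0 -(pmulr_rge0 _ th2') f'mv subr_ge0.
Qed.

(** On the left half, with [D = f' m - f' u >= 0], the chord slope exceeds [f' u]
    by [(1 - 2 theta) D], which has to lie between [theta D] and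
    [(1 - theta) D]; this is where [theta <= 1/3] enters. The right half is
    symmetric. *)
Lemma convexity_range_dyadic (R : realType) (theta c d : R) (f f' : R -> R) :
  0 <= theta -> 3 * theta <= 1 -> c < d -> merrien_scheme theta c d f f' ->
  convexity_range theta f f' c d ->
  forall u v, dyadic_subitv c d u v -> convexity_range theta f f' u v.
Proof.
move=> th0 th3 cd scheme range_cd u v.
have th2 : 2 * theta < 1 by lra.
elim=> [//|u' v' cduv range|u' v' cduv range];
  have /andP[f'um f'mv] := derivative_mid_between th2 cd scheme cduv range;
  have [_ _ um mv] := merrien_halves th2 cd scheme cduv;
  rewrite /convexity_range ?um ?mv; apply/andP; split; nra.
Qed.

(** All dyadic intervals satisfy [convexity_range], so on each of them bisection
    never takes [f'] outside its two endpoint values; by continuity this holds at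
    every point of the interval. *)
Lemma merrien_derivative_nondecreasing (R : realType) (theta c d : R) (f f' : R -> R) :
  0 <= theta -> 3 * theta <= 1 -> c < d -> merrien_scheme theta c d f f' ->
  {within `[c, d], continuous f'} -> convexity_range theta f f' c d ->
  {in `[c, d] &, {homo f' : s t / s <= t}}.
Proof.
move=> th0 th3 cd scheme f'_cont range_cd.
have th2 : 2 * theta < 1 by lra.
have range := convexity_range_dyadic th0 th3 cd scheme range_cd.
have f'_mid s t : dyadic_subitv c d s t -> f' s <= f' ((s + t) / 2) <= f' t.
  by move=> cdst; exact: (derivative_mid_between th2 cd scheme cdst (range _ _ cdst)).
apply: dyadic_nondecreasing => // u v cduv.
have [cu uv vd] := dyadic_subitv_bounds cd cduv.
have f'_cont_uv : {within `[u, v], continuous f'}.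
  apply: continuous_subspaceW f'_cont => z /=; rewrite !in_itv/= => /andP[uz zv].
  by rewrite (le_trans cu uz) (le_trans zv vd).
apply: (@dyadic_closed _ u v f' [set z | f' u <= z <= f' v]) => //.
  rewrite (_ : mkset _ = [set` `[f' u, f' v]]); first exact: itv_closed.
  by apply/seteqP; split=> z; rewrite /= in_itv.
move=> s t uvst /=.
suff /and3P[us st tv] : [&& f' u <= f' s, f' s <= f' t & f' t <= f' v].
  by rewrite us (le_trans st tv).
elim: uvst => [|s' t' uvst|s' t' uvst].
- by rewrite !lexx /= andbT; case/andP: (f'_mid _ _ cduv); exact: le_trans.
- move=> /and3P[us st tv].
  have /andP[sm mt] := f'_mid _ _ (dyadic_subitv_trans cduv uvst).
  by rewrite us sm (le_trans mt tv).
- move=> /and3P[us st tv].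
  have /andP[sm mt] := f'_mid _ _ (dyadic_subitv_trans cduv uvst).
  by rewrite (le_trans us sm) mt tv.
Qed.

(** * Quadratic splines *)

(** For [theta = 1/4] both subdivision identities hold exactly for quadratics. A
    chord slope equal to the mean of the end derivatives says that the Hermite data
    are those of a quadratic, which therefore agrees with [f] at all dyadic
    points. *)
Lemma merrien_quarter_quadratic (R : realType) (u v : R) (f f' : R -> R) :
  u < v -> merrien_scheme 4^-1 u v f f' -> {within `[u, v], continuous f} ->
  chord f u v = (f' u + f' v) / 2 ->
  exists2 q : {poly R}, (size q <= 3)%N & {in `[u, v], forall t, f t = q.[t]}.
Proof.
move=> uv scheme f_cont mean.
pose k := (f' v - f' u) / (v - u).
pose q : {poly R} :=
  (f u)%:P + f' u *: ('X - u%:P) + (k / 2) *: ('X - u%:P) ^+ 2.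
have qE t : q.[t] = f u + f' u * (t - u) + k / 2 * (t - u) ^+ 2.
  by rewrite /q !hornerE.
exists q.
  rewrite /q (leq_trans (size_polyD _ _)) // geq_max.
  rewrite (leq_trans (size_polyD _ _)) ?(leq_trans (size_scale_leq _ _))
    ?size_exp_XsubC //.
  rewrite geq_max (leq_trans (size_polyC_leq1 _)) //.
  by rewrite (leq_trans (size_scale_leq _ _)) // size_XsubC.
have h0 : v - u != 0 by rewrite subr_eq0 gt_eqF.
have fv : f v = f u + (v - u) * ((f' u + f' v) / 2).
  by rewrite -mean /chord mulrC divfK // addrC subrK.
have on_dyadic s t : dyadic_subitv u v s t ->
    [/\ f s = q.[s], f t = q.[t],
        f' s = f' u + k * (s - u) & f' t = f' u + k * (t - u)].
  elim=> [|s' t' uvst [fs ft f's f't]|s' t' uvst [fs ft f's f't]].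
  - rewrite !qE fv /k; split; field => //.
  - have [_ st _] := dyadic_subitv_bounds uv uvst.
    have st0 : t' - s' != 0 by rewrite subr_eq0 gt_eqF.
    have [-> ->] := scheme _ _ uvst; rewrite fs ft f's f't !qE.
    by split=> //; field.
  - have [_ st _] := dyadic_subitv_bounds uv uvst.
    have st0 : t' - s' != 0 by rewrite subr_eq0 gt_eqF.
    have [-> ->] := scheme _ _ uvst; rewrite fs ft f's f't !qE.
    by split=> //; field.
move=> t t_in; apply/eqP; rewrite -subr_eq0; apply/eqP; move: t t_in.
apply: (@dyadic_closed _ u v (fun t => f t - q.[t]) [set 0]) => //.
- move=> z; apply: cvgB; first exact: f_cont.
  by apply: continuous_subspaceT => y; exact: continuous_horner.
- by move=> s t /on_dyadic[-> _ _ _] /=; rewrite subrr.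
Qed.

(** * Shape of a generalized quadratic spline *)

Lemma theta_of_betaK (R : realType) (theta : R) :
  2 * theta < 1 -> theta_of_beta (beta_of_theta theta) = theta.
Proof.
move=> th2; have th0 : 1 - 2 * theta != 0 by rewrite subr_eq0 gt_eqF.
rewrite /theta_of_beta /beta_of_theta.
have -> : - (2 * theta) / (1 - 2 * theta) - 1 = - (1 - 2 * theta)^-1 by field.
by field.
Qed.

Lemma V_space_merrien (R : realType) (theta c d : R) (f : R -> R) :
  2 * theta < 1 -> V_space (beta_of_theta theta) c d f ->
  merrien_scheme theta c d f (derive_itv c d f).
Proof. by move=> th2 [_ scheme] u v /scheme; rewrite /= theta_of_betaK. Qed.

Lemma V_space_increasing_convex (R : realType) (theta c d : R) (f : R -> R) :
  0 <= theta -> 3 * theta <= 1 -> c < d ->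
  V_space (beta_of_theta theta) c d f -> 0 <= derive_itv c d f c ->
  convexity_range theta f (derive_itv c d f) c d ->
  increasing_on c d f /\ convex_on c d f.
Proof.
move=> th0 th3 cd Vf f'c range.
have th2 : 2 * theta < 1 by lra.
have scheme := V_space_merrien th2 Vf.
have [fC1 _] := Vf; have [_ f'_cont] := fC1.
have f'_mono := merrien_derivative_nondecreasing th0 th3 cd scheme f'_cont range.
apply: increasing_convex_of_derive => // x x_in; apply: (le_trans f'c).
have /andP[cx _] : c <= x <= d by [].
by apply: f'_mono => //; rewrite in_itv/= lexx ltW.
Qed.

(** After one bisection with [theta = 1/4] the chord slope over the left half is
    [f' c + (f' m - f' c) / 2], the mean of the derivatives at its ends, and
    likewise over the right half. *)
Lemma V_space_quarter_quadratic_spline (R : realType) (c d : R) (f : R -> R) :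
  c < d -> V_space (beta_of_theta 4^-1) c d f -> quadratic_spline c d f.
Proof.
move=> cd Vf; have th2 : 2 * 4^-1 < 1 :> R by lra.
have scheme := V_space_merrien th2 Vf; have [fC1 _] := Vf.
have f_cont := C1_itv_continuous fC1.
have [_ _ cm md] := merrien_halves th2 cd scheme (dyadic_self c d).
have half_quadratic u v : dyadic_subitv c d u v ->
    chord f u v = (derive_itv c d f u + derive_itv c d f v) / 2 ->
    exists2 q : {poly R}, (size q <= 3)%N & {in `[u, v], forall t, f t = q.[t]}.
  move=> cduv mean; have [cu uv vd] := dyadic_subitv_bounds cd cduv.
  apply: merrien_quarter_quadratic mean => //.
    by move=> s t uvst; apply: scheme; exact: dyadic_subitv_trans uvst.
  apply: continuous_subspaceW f_cont => z /=; rewrite !in_itv/= => /andP[uz zv].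
  by rewrite (le_trans cu uz) (le_trans zv vd).
have [|q1 size1 f1] := half_quadratic _ _ (dyadic_left (dyadic_self c d)).
  by rewrite cm; field.
have [|q2 size2 f2] := half_quadratic _ _ (dyadic_right (dyadic_self c d)).
  by rewrite md; field.
by split=> //; exists q1, q2.
Qed.

Lemma partition_subitv (R : realType) (a b : R) (n : nat) (x : nat -> R) (i : nat) :
  is_partition a b n x -> (1 <= i <= n)%N ->
  [/\ a <= x i.-1, x i.-1 < x i & x i <= b].
Proof.
move=> [x0 xn x_incr] i1n.
have x_le k j : (k + j <= n)%N -> x k <= x (k + j)%N.
  elim: j => [|j IHj] kjn; first by rewrite addn0.
  rewrite addnS; rewrite addnS in kjn; apply: le_trans (IHj (ltnW kjn)) _.
  by apply: ltW; apply: (x_incr (k + j).+1).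
have /andP[i1 i_n] := i1n.
split; last 1 first.
- by rewrite -xn -[in leRHS](subnKC i_n) x_le // subnKC.
- by rewrite -x0 -[i.-1]add0n x_le // add0n (leq_trans (leq_pred i)).
- exact: x_incr.
Qed.

Theorem theorem5 (R : realType) (n : nat) (a b : R) (x y p theta : nat -> R)
    (g : R -> R)
    (n_ge1 : (1 <= n)%N)
    (X_partition : is_partition a b n x)
    (data_ineq : forall i, (1 <= i <= n)%N ->
       0 < p i.-1 /\ p i.-1 < slope x y i /\ slope x y i < p i)
    (theta_range : forall i, (1 <= i <= n)%N -> 0 < theta i <= 4^-1)
    (g_GS2 : GS2 a b n x (fun i => beta_of_theta (theta i)) g)
    (g_hermite : forall i, (i <= n)%N ->
       g (x i) = y i /\ derive_itv a b g (x i) = p i) :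
  forall i, (1 <= i <= n)%N ->
    let tau := slope x y i in
    (* (i) *)
    (4^-1 * (3 * p i.-1 + p i) <= tau <= 4^-1 * (p i.-1 + 3 * p i) ->
       theta i = 4^-1 ->
       [/\ increasing_on (x i.-1) (x i) g,
           convex_on (x i.-1) (x i) g &
           quadratic_spline (x i.-1) (x i) g]) /\
    (* (ii)(a) *)
    (tau < 4^-1 * (3 * p i.-1 + p i) ->
       let theta_bar := (tau - p i.-1) / (p i - p i.-1) in
       0 < theta_bar <= 4^-1 /\
       (theta i <= theta_bar ->
        [/\ increasing_on (x i.-1) (x i) g,
            convex_on (x i.-1) (x i) g &
            V_space (beta_of_theta (theta i)) (x i.-1) (x i) g])) /\
    (* (ii)(b) *)
    (tau > 4^-1 * (p i.-1 + 3 * p i) ->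
       let theta_bar := (p i - tau) / (p i - p i.-1) in
       0 < theta_bar <= 4^-1 /\
       (theta i <= theta_bar ->
        [/\ increasing_on (x i.-1) (x i) g,
            convex_on (x i.-1) (x i) g &
            V_space (beta_of_theta (theta i)) (x i.-1) (x i) g])).
Proof.
move=> i i1n tau.
have /andP[th0 th4] := theta_range i i1n.
have [p0 [ptau taup]] := data_ineq i i1n; rewrite -/tau in ptau taup.
have [ax cd xb] := partition_subitv X_partition i1n.
have [[g_cvg _] /(_ i i1n) Vg] := g_GS2.
have /andP[i1 i_n] := i1n.
have [gc g'c] := g_hermite i.-1 (leq_trans (leq_pred i) i_n).
have [gd g'd] := g_hermite i i_n.
have c_in : x i.-1 \in `[x i.-1, x i] by rewrite in_itv/= lexx ltW.
have d_in : x i \in `[x i.-1, x i] by rewrite in_itv/= lexx ltW.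
have in_ab t : t \in `[x i.-1, x i] -> t \in `[a, b].
  by rewrite !in_itv/= => /andP[ct td]; rewrite (le_trans ax ct) (le_trans td xb).
have f'c : derive_itv (x i.-1) (x i) g (x i.-1) = p i.-1.
  by rewrite -g'c; apply: derive_itv_subitv => //; exact: g_cvg (in_ab _ c_in).
have f'd : derive_itv (x i.-1) (x i) g (x i) = p i.
  by rewrite -g'd; apply: derive_itv_subitv => //; exact: g_cvg (in_ab _ d_in).
have chordE : chord g (x i.-1) (x i) = tau by rewrite /chord gc gd.
have increasing_convex :
    p i.-1 + theta i * (p i - p i.-1) <= tau <= p i - theta i * (p i - p i.-1) ->
    increasing_on (x i.-1) (x i) g /\ convex_on (x i.-1) (x i) g.
  move=> range; apply: (@V_space_increasing_convex _ (theta i)) => //.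
  - exact: ltW.
  - by lra.
  - by rewrite f'c ltW.
  - by rewrite /convexity_range f'c f'd chordE.
have p_lt : p i.-1 < p i by exact: lt_trans taup.
have pp : 0 < p i - p i.-1 by rewrite subr_gt0.
(* the bound not given by the choice of theta in (a) or (b) comes from
   theta <= 1/4 and the failure of one of the inequalities of (i) *)
have th_pp : theta i * (p i - p i.-1) <= 4^-1 * (p i - p i.-1).
  by rewrite ler_wpM2r // ltW.
split; [|split].
- move=> /andP[lo hi] th.
  have [|incr conv] := increasing_convex.
    by rewrite th; apply/andP; split; lra.
  by split=> //; apply: V_space_quarter_quadratic_spline => //; rewrite -th.
- move=> lo theta_bar; split.
    rewrite /theta_bar divr_gt0 ?subr_gt0 //= ler_pdivrMr //; lra.
  rewrite /theta_bar ler_pdivlMr // => th.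
  have [|incr conv] := increasing_convex; last by split.
  by apply/andP; split; lra.
- move=> hi theta_bar; split.
    rewrite /theta_bar divr_gt0 ?subr_gt0 //= ler_pdivrMr //; lra.
  rewrite /theta_bar ler_pdivlMr // => th.
  have [|incr conv] := increasing_convex; last by split.
  by apply/andP; split; lra.
Qed.
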